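(* Let $n\ge2$ and let $f\colon\mathbb{R}^n\to\mathbb{R}^n$ be an entire quasiregular map of transcendental type with an attracting fixed point $\xi$, and let $A(\xi)=\{x\in\mathbb{R}^n: f^k(x)\to\xi\text{ as }k\to\infty\}$ be its attracting basin. Then $J(f)\cap A(\xi)=\emptyset$ and $J(f)\subset\partial A(\xi)$.
   Context: A continuous map $f\colon\mathbb{R}^n\to\mathbb{R}^n$ ($n\ge2$) belonging to the Sobolev space $W^1_{n,\mathrm{loc}}(\mathbb{R}^n)$ is quasiregular if there is a constant $K_O\ge 1$ with $|Df(x)|^n\le K_O J_f(x)$ for almost every $x$, where $|Df(x)|$ is the operator norm of the derivative and $J_f$ the Jacobian determinant. Quasiregular self-maps of $\mathbb{R}^n$ are called entire quasiregular maps. Such a map is of transcendental type if $\lim_{x\to\infty}|f(x)|$ does not exist (neither as a finite number nor as $\infty$); here $|\cdot|$ is the Euclidean norm. $f^k$ denotes the $k$-th iterate. A fixed point $\xi$ of $f$ is attracting if it has a neighbourhood $U$ such that $f^k|_U\to\xi$ uniformly as $k\to\infty$. Capacity: for an open set $A\subset\mathbb{R}^n$ and a non-empty compact $C\subset A$, $\operatorname{cap}(A,C)=\inf_u\int_A|\nabla u|^n\,dm$, the infimum over all non-negative $u\in C_0^\infty(A)$ with $u\ge1$ on $C$. A compact set $C$ has capacity zero, written $\operatorname{cap} C=0$, if $\operatorname{cap}(A,C)=0$ for some (equivalently every) bounded open $A\supset C$; an unbounded closed set has capacity zero if each of its compact subsets has capacity zero; the empty set has capacity zero. Otherwise the set has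 positive capacity, written $\operatorname{cap} C>0$. The Julia set $J(f)$ is the set of all $x\in\mathbb{R}^n$ such that $\operatorname{cap}\left(\mathbb{R}^n\setminus\bigcup_{k=1}^\infty f^k(U)\right)=0$ for every (open) neighbourhood $U$ of $x$. *)

(* Defs.v *)
From HB Require Import structures.
From mathcomp Require Import all_boot all_order all_algebra.
From mathcomp Require Import all_classical all_reals all_analysis.

Set Implicit Arguments.
Unset Strict Implicit.
Unset Printing Implicit Defensive.

Import Order.TTheory GRing.Theory Num.Theory.
Import numFieldNormedType.Exports.

Local Open Scope classical_set_scope.
Local Open Scope ring_scope.

(* R^n is 'rV[R]_n.  The library equips it with its topology (through the
   sup norm `|x|) but with neither a sigma-algebra nor a measure.  It receives
   the product sigma-algebra (as the library does for n.-tuple), and Lebesgue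
   measure is defined by iterating the library's product measure along
   R^(n+1) = R * R^n. *)

Definition measure_rV_display : measure_display -> measure_display.
Proof. exact. Qed.

Section measurable_rV.
Context {d} {T : sigmaRingType d}.
Variable n : nat.

Let coors : 'I_n -> 'rV[T]_n -> T := fun i x => x ord0 i.

Let rV_set0 : g_sigma_preimage coors set0.
Proof. exact: sigma_algebra0. Qed.

Let rV_setC A : g_sigma_preimage coors A -> g_sigma_preimage coors (~` A).
Proof. exact: sigma_algebraC. Qed.

Let rV_bigcup (F : _^nat) : (forall i, g_sigma_preimage coors (F i)) ->
  g_sigma_preimage coors (\bigcup_i (F i)).
Proof. exact: sigma_algebra_bigcup. Qed.

HB.instance Definition _ := @isMeasurable.Build (measure_rV_display d)
  'rV[T]_n (g_sigma_preimage coors) rV_set0 rV_setC rV_bigcup.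

End measurable_rV.

Section lebesgue_rV.
Context {R : realType}.

Definition row_cons n (p : measurableTypeR R * 'rV[R]_n) : 'rV[R]_n.+1 :=
  row_mx (p.1%:M : 'M[R]_1) p.2.

Lemma row_cons0 n p : @row_cons n p ord0 ord0 = p.1.
Proof.
rewrite /row_cons (_ : ord0 = lshift n (ord0 : 'I_1)); last exact/val_inj.
by rewrite (@row_mxEl _ _ 1 n) mxE eqxx.
Qed.

Lemma row_consS n p (i : 'I_n) :
  @row_cons n p ord0 (lift ord0 i) = p.2 ord0 i.
Proof.
rewrite /row_cons (_ : lift ord0 i = rshift 1 i); last exact/val_inj.
by rewrite (@row_mxEr _ _ 1 n).
Qed.

Lemma measurable_coord n (i : 'I_n) :
  measurable_fun [set: 'rV[R]_n] (fun x => x ord0 i).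
Proof.
move=> _ Y mY; rewrite setTI; apply: sub_sigma_algebra => /=.
rewrite -bigcup_seq/=; exists i => /=; first by rewrite mem_index_enum.
by exists Y => //; rewrite setTI.
Qed.

Lemma measurable_rVP d (T : measurableType d) n (f : T -> 'rV[R]_n) :
  (forall i, measurable_fun setT (fun x => f x ord0 i)) -> measurable_fun setT f.
Proof.
move=> mf; apply: (measurability (\big[setU/set0]_(i < n)
  preimage_set_system setT (fun x : 'rV[R]_n => x ord0 i) measurable)) => //.
move=> _ [A + <-].
rewrite -bigcup_seq/= => -[i _ [B mB <-]].
rewrite !setTI -[X in measurable X]setTI; exact: mf.
Qed.

Lemma measurable_row_cons n : measurable_fun setT (@row_cons n).
Proof.
apply: measurable_rVP => j; case: (unliftP ord0 j) => [i ->|->].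
  rewrite (_ : (fun _ => _) = (fun x : 'rV[R]_n => x ord0 i) \o snd).
    by apply: measurableT_comp; [exact: measurable_coord|exact: measurable_snd].
  by apply/funext => p /=; rewrite row_consS.
rewrite (_ : (fun _ => _) = fst); first exact: measurable_fst.
by apply/funext => p /=; rewrite row_cons0.
Qed.

Lemma measurable_row_uncons n : measurable_fun setT
  (fun v : 'rV[R]_n.+1 => (v ord0 ord0 : measurableTypeR R,
                            \row_i v ord0 (lift ord0 i) : 'rV[R]_n)).
Proof.
apply/measurable_fun_pair; first exact: measurable_coord.
apply: measurable_rVP => i; under eq_fun do rewrite mxE.
exact: measurable_coord.
Qed.

Section lebesgue_rV_step.
Variables (n : nat) (m : {sigma_finite_measure set 'rV[R]_n -> \bar R}).

Definition lebesgue_rV_step : set 'rV[R]_n.+1 -> \bar R :=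
  pushforward (lebesgue_measure \x m)%E (@row_cons n).

Let preimage_row_consT B : measurable B -> measurable (@row_cons n @^-1` B).
Proof.
by move=> mB; rewrite -[X in measurable X]setTI; exact: measurable_row_cons.
Qed.

Let step0 : lebesgue_rV_step set0 = 0%E.
Proof. by rewrite /lebesgue_rV_step /pushforward preimage_set0 measure0. Qed.

Let step_ge0 A : (0 <= lebesgue_rV_step A)%E.
Proof. by rewrite /lebesgue_rV_step /pushforward; exact: measure_ge0. Qed.

Let step_sigma_additive : semi_sigma_additive lebesgue_rV_step.
Proof.
move=> F mF tF mUF; rewrite /lebesgue_rV_step /pushforward preimage_bigcup.
apply: measure_semi_sigma_additive.
- by move=> k; exact: preimage_row_consT.
- apply/trivIsetP => /= i j _ _ ij; rewrite -preimage_setI.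
  by move/trivIsetP : tF => /(_ _ _ _ _ ij) ->//; rewrite preimage_set0.
- by rewrite -preimage_bigcup; exact: preimage_row_consT.
Qed.

HB.instance Definition _ := isMeasure.Build _ _ _ lebesgue_rV_step
  step0 step_ge0 step_sigma_additive.

Let step_sigma_finite : sigma_finite setT lebesgue_rV_step.
Proof.
pose g (v : 'rV[R]_n.+1) : measurableTypeR R * 'rV[R]_n :=
  (v ord0 ord0, \row_i v ord0 (lift ord0 i)).
have /sigma_finiteP[F [FT ndF Foo]] :=
  sigma_finiteT (@lebesgue_measure R : {sigma_finite_measure set _ -> \bar R}).
have /sigma_finiteP[G [GT ndG Goo]] := sigma_finiteT m.
exists (fun k => g @^-1` (F k `*` G k)).
  rewrite -preimage_bigcup -(preimage_setT g); congr (_ @^-1` _).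
  apply/seteqP; split => [[x v] _|//].
  have [i _ Fx] : (\bigcup_k F k) x by rewrite -FT.
  have [j _ Gv] : (\bigcup_k G k) v by rewrite -GT.
  exists (maxn i j) => //; split => /=.
    by move: x Fx; exact/subsetPset/ndF/leq_maxl.
  by move: v Gv; exact/subsetPset/ndG/leq_maxr.
move=> k; have [mF Fk] := Foo k; have [mG Gk] := Goo k; split.
  rewrite -[X in measurable X]setTI; apply: measurable_row_uncons => //.
  exact: measurableX.
rewrite /lebesgue_rV_step /pushforward -comp_preimage.
rewrite (_ : g \o _ = id); last first.
  apply/funext => -[x v]; rewrite /g /= row_cons0.
  by congr pair; apply/rowP => i; rewrite mxE row_consS.
by rewrite preimage_id product_measure1E// lte_mul_pinfty// ge0_fin_numE.
Qed.

HB.instance Definition _ := Measure_isSigmaFinite.Build _ _ _ lebesgue_rV_step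
  step_sigma_finite.

End lebesgue_rV_step.

Fixpoint lebesgue_rV n : {sigma_finite_measure set 'rV[R]_n -> \bar R} :=
  if n is n'.+1 then lebesgue_rV_step (lebesgue_rV n') else \d_(0 : 'rV[R]_0).

(* This property characterizes lebesgue_rV n. *)
Lemma lebesgue_rV_box n (A : 'I_n -> set R) : (forall i, measurable (A i)) ->
  lebesgue_rV n [set x | forall i, A i (x ord0 i)] =
  (\prod_(i < n) lebesgue_measure (A i))%E.
Proof.
elim: n => [|n IH] in A *; move=> mA.
  rewrite big_ord0 /= diracE (_ : _ \in _)//.
  by rewrite inE /= => -[].
rewrite big_ord_recl -IH//=.
set B := [set x : 'rV[R]_n | forall i, A (lift ord0 i) (x ord0 i)].
have mB : measurable B.
  rewrite (_ : B = \big[setI/setT]_(i < n)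
      ((fun x : 'rV[R]_n => x ord0 i) @^-1` A (lift ord0 i))).
    apply: bigsetI_measurable => i _; rewrite -[X in measurable X]setTI.
    exact: measurable_coord.
  rewrite -bigcap_seq; apply/seteqP; split=> x /= Ax i.
    by move=> _; exact: Ax.
  by apply: Ax => /=; rewrite mem_index_enum.
transitivity ((lebesgue_measure \x lebesgue_rV n)%E (A ord0 `*` B)); last first.
  by rewrite product_measure1E//; exact: mA.
rewrite /lebesgue_rV_step /pushforward.
congr (_ _); apply/seteqP; split=> -[x v] /=.
  move=> Axv; split => [|i]; first by have := Axv ord0; rewrite row_cons0.
  by have := Axv (lift ord0 i); rewrite row_consS.
move=> [Ax Av] j; case: (unliftP ord0 j) => [i ->|->].
  by rewrite row_consS; exact: Av.
by rewrite row_cons0.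
Qed.

End lebesgue_rV.

Section euclidean.
Context {R : realType} {n : nat}.
Implicit Types x v : 'rV[R]_n.

Definition enorm x : R := Num.sqrt (\sum_(i < n) x ord0 i ^+ 2).

(* Matrices act on row vectors by v |-> v *m A. *)
Definition opnorm (A : 'M[R]_n) : R :=
  sup [set enorm (v *m A) | v in [set v | enorm v <= 1]].

Definition at_infinity : set_system 'rV[R]_n :=
  [set P | exists M : R, forall x, M < enorm x -> P x].

Definition partial (i : 'I_n) (u : 'rV[R]_n -> R) : 'rV[R]_n -> R :=
  'D_(delta_mx ord0 i) u.

Definition gradient (u : 'rV[R]_n -> R) x : 'rV[R]_n := \row_i partial i u x.

Fixpoint Ck k (u : 'rV[R]_n -> R) : Prop :=
  if k is k'.+1 then
    continuous u /\
    forall i, (forall x, derivable u x (delta_mx ord0 i)) /\ Ck k' (partial i u)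
  else continuous u.

Definition smooth (u : 'rV[R]_n -> R) := forall k, Ck k u.

(* Elements of C_0^oo(A) are viewed as functions on R^n, extended by 0. *)
Definition test_function (A : set 'rV[R]_n) (u : 'rV[R]_n -> R) :=
  let supp := closure [set x | u x != 0] in
  [/\ smooth u, compact supp & supp `<=` A].

End euclidean.

Section quasiregular.
Context {R : realType} {n : nat}.
Local Notation mu := (lebesgue_rV n : {measure set 'rV[R]_n -> \bar R}).

Definition Lp_loc (p : nat) (u : 'rV[R]_n -> R) :=
  measurable_fun setT u /\
  forall K : set 'rV[R]_n, compact K ->
    (\int[mu]_(x in K) (`|u x| ^+ p)%:E < +oo)%E.

Definition weak_partial (i : 'I_n) (u g : 'rV[R]_n -> R) :=
  forall phi : 'rV[R]_n -> R, test_function setT phi ->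
    (\int[mu]_x (u x * partial i phi x)%:E =
     - \int[mu]_x (g x * phi x)%:E)%E.

(* f is in W^1_{p,loc}(R^n) and its weak derivative is Df, where
   Df x i j is the i-th weak partial derivative of the j-th component of f
   (the row-vector convention of the library's jacobian). *)
Definition W1p_loc_derivative (p : nat) (f : 'rV[R]_n -> 'rV[R]_n)
    (Df : 'rV[R]_n -> 'M[R]_n) :=
  (forall j, Lp_loc p (fun x => f x ord0 j)) /\
  forall i j, Lp_loc p (fun x => Df x i j) /\
    weak_partial i (fun x => f x ord0 j) (fun x => Df x i j).

(* The weak derivative is unique up to a null set, so the choice of Df (and its
   being Borel rather than Lebesgue measurable) is immaterial. *)
Definition quasiregular (f : 'rV[R]_n -> 'rV[R]_n) :=
  continuous f /\
  exists Df, W1p_loc_derivative n f Df /\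
    exists K_O : R, 1 <= K_O /\
      {ae mu, forall x, opnorm (Df x) ^+ n <= K_O * \det (Df x)}.

Definition transcendental_type (f : 'rV[R]_n -> 'rV[R]_n) :=
  ~ exists l : \bar R, (enorm (f x))%:E @[x --> at_infinity] --> l.

Definition capacity (A C : set 'rV[R]_n) : \bar R :=
  ereal_inf [set (\int[mu]_(x in A) (enorm (gradient u x) ^+ n)%:E)%E | u in
    [set u | [/\ test_function A u, forall x, 0 <= u x &
                 forall x, C x -> 1 <= u x]]].

Definition compact_capacity_zero (C : set 'rV[R]_n) :=
  exists A, [/\ bounded_set A, open A, C `<=` A & capacity A C = 0%E].

(* Capacity zero is defined for closed sets only. *)
Definition capacity_zero (E : set 'rV[R]_n) :=
  [\/ E = set0,
      [/\ E !=set0, compact E & compact_capacity_zero E]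
    | [/\ closed E, ~ bounded_set E &
          forall C, C !=set0 -> compact C -> C `<=` E ->
            compact_capacity_zero C]].

End quasiregular.

Section dynamics.
Context {R : realType} {n : nat}.
Implicit Types (f : 'rV[R]_n -> 'rV[R]_n) (xi : 'rV[R]_n).

Definition julia f : set 'rV[R]_n :=
  [set x | forall U, open U -> U x ->
    capacity_zero (~` \bigcup_(k in [set k | (0 < k)%N]) (iter k f @` U))].

Definition attracting_fixed_point f xi :=
  f xi = xi /\
  exists2 U, nbhs xi U & {uniform U, iter k f @[k --> \oo] --> cst xi}.

Definition basin f xi : set 'rV[R]_n :=
  [set x | iter k f x @[k --> \oo] --> xi].

Definition boundary (A : set 'rV[R]_n) := closure A `\` interior A.

End dynamics.

(* Main.v *)
(* A set of capacity zero contains no cube, whereas the complement of the union of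
   the f^k(U) does contain one for small U, unless x is a boundary point of the
   basin outside the basin.

   Cubes have positive capacity: a test function equals at least 1 on the cube
   and vanishes far away on every line parallel to the first axis, so its
   gradient has integral at least 1 along each such line meeting the cube.
   Jensen's inequality (in the form of a tangent-line bound for t^n) bounds the
   integral of the n-th power along the line below, and Tonelli concludes.

   If x is in the basin, the iterates of a small neighbourhood U of x stay in a
   bounded set, so the complement of the union of the f^k(U) contains a cube far
   away.  If x is outside the closure of the basin, the complement of that
   closure is a neighbourhood of x whose iterates avoid the basin, hence avoid a
   cube around xi.  In both cases x is not in the Julia set. *)
Require Import Defs.
From HB Require Import structures.
From mathcomp Require Import all_boot all_order all_algebra.
From mathcomp Require Import all_classical all_reals all_analysis.
From mathcomp Require Import measurable_realfun ring lra.

Import Order.TTheory GRing.Theory Num.Theory.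
Import numFieldNormedType.Exports.

Local Open Scope classical_set_scope.
Local Open Scope ring_scope.

(** * Borel measurability in R^n with the product sigma-algebra *)

Section rV_borel.
Context {R : realType} {n : nat}.

Lemma measurable_rV_box (A : 'I_n -> set R) : (forall i, measurable (A i)) ->
  measurable [set x : 'rV[R]_n | forall i, A i (x ord0 i)].
Proof.
move=> mA; rewrite [X in measurable X](_ : _ = \big[setI/setT]_(i < n)
    ((fun x : 'rV[R]_n => x ord0 i) @^-1` A i)); last first.
  rewrite -bigcap_seq; apply/seteqP; split=> x /= Ax i.
    by move=> _; apply: Ax.
  by apply: Ax => /=; rewrite mem_index_enum.
apply: bigsetI_measurable => i _; rewrite -[X in measurable X]setTI.
exact: measurable_coord.
Qed.

(** An open set is the union of the countably many cubes with rational centre and radius [1/(k+1)]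
    that it contains, and each cube is a measurable box. *)
Lemma open_measurable_rV (O : set 'rV[R]_n) : open O -> measurable O.
Proof.
move=> oO.
pose B (p : 'rV[rat]_n * nat) : set 'rV[R]_n :=
  [set x | forall i, ball (ratr (p.1 ord0 i) : R) p.2.+1%:R^-1 (x ord0 i)].
pose F p : set 'rV[R]_n := if `[< B p `<=` O >] then B p else set0.
have -> : O = \bigcup_p F p.
  apply/seteqP; split => [x Ox|x [p _]]; last first.
    by rewrite /F; case: asboolP => // + Bx; apply.
  have /nbhs_ballP[e /= e0 xeO] : nbhs x O by exact: open_nbhs_nbhs.
  (* Twice the radius [1/(k+1)] is below [e], so a cube of that radius whose centre is within the
     radius of [x] stays in the [e]-ball around [x]. *)
  pose k := Num.truncn (2 / e).
  have ke : k.+1%:R^-1 * 2 < e.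
    rewrite mulrC ltr_pdivrMr// mulrC -ltr_pdivrMr//.
    exact: truncnS_gt.
  have q_ i : {q : rat | ball (x ord0 i) k.+1%:R^-1 (ratr q : R)}.
    apply: cid; have : x ord0 i < x ord0 i + k.+1%:R^-1.
      by rewrite ltrDl invr_gt0.
    move=> /rat_in_itvoo[q]; rewrite inE => /andP[xq qx]; exists q.
    by rewrite /ball/= distrC ger0_norm ?subr_ge0 ?ltrBlDl// ltW.
  pose q : 'rV[rat]_n := \row_i projT1 (q_ i).
  exists (q, k) => //; rewrite /F; case: asboolP => [_ i|].
    by rewrite /= mxE; apply: ball_sym; exact: projT2 (q_ i).
  case=> y Bqy; apply: xeO; split => // i j; rewrite (ord1 i).
  apply: (le_ball (ltW ke)); rewrite mulr_natr mulr2n.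
  apply: (@ball_triangle _ _ (ratr (projT1 (q_ j)) : R)).
    exact: projT2 (q_ j).
  by have /= := Bqy j; rewrite mxE.
apply: countable_bigcupT_measurable => [//|p].
rewrite /F; case: asboolP => // _.
apply: (@measurable_rV_box
  (fun i => ball (ratr (p.1 ord0 i) : R) p.2.+1%:R^-1)) => i.
by apply: open_measurable; apply: ball_open; rewrite invr_gt0.
Qed.

Lemma continuous_measurable_rV (g : 'rV[R]_n -> R) :
  continuous g -> measurable_fun setT g.
Proof.
move=> cg; apply: (measurability _ (RGenOpens.measurableE R)).
move=> _ [_ [a [b ->] <-]]; rewrite setTI; apply: open_measurable_rV.
by move/continuousP : cg; apply; exact: interval_open.
Qed.

End rV_borel.

(** * Continuity of the gradient, and restriction to lines parallel to the first axis *)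

Section enorm_gradient.
Context {R : realType}.

Lemma continuous_enorm n : continuous (@enorm R n).
Proof.
move=> x; apply: continuous_comp; last exact: sqrt_continuous.
apply: continuous_big => [|i _ y]; first exact: add_continuous.
apply: (@continuous_comp _ _ _ (fun x : 'rV[R]_n => x ord0 i)
  (fun t : R => t ^+ 2)).
  exact: coord_continuous.
exact: exprn_continuous.
Qed.

Lemma coord_le_enorm n (x : 'rV[R]_n) i : x ord0 i <= enorm x.
Proof.
apply: le_trans (ler_norm _) _; rewrite -sqrtr_sqr ler_wsqrtr//.
by rewrite (bigD1 i)//= lerDl sumr_ge0// => j _; rewrite sqr_ge0.
Qed.

Lemma continuous_gradient n (u : 'rV[R]_n -> R) :
  (forall i, continuous (partial i u)) -> continuous (gradient u).
Proof.
move=> cu x P /nbhs_ballP[e e0 eP].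
have : \forall y \near x, forall i, ball (partial i u x) e (partial i u y).
  apply: (@filter_forall _ _ _ _ (nbhs_filter x)) => i.
  by have /cvg_ballP := cu i x; apply.
apply: (@filterS _ _ (nbhs_filter x)) => y uy; apply: eP.
by split => // i j; rewrite !mxE; exact: uy.
Qed.

Lemma row_cons_shift m (t h : R) (v : 'rV[R]_m) :
  row_cons (h + t, v) = h *: delta_mx ord0 ord0 + row_cons (t, v).
Proof.
apply/rowP => j; rewrite [RHS]mxE; case: (unliftP ord0 j) => [i ->|->].
  by rewrite !row_consS/= !mxE mulr0 add0r.
by rewrite !row_cons0/= !mxE mulr1.
Qed.

Lemma continuous_row_cons m (v : 'rV[R]_m) :
  continuous (fun t : R => row_cons (t, v)).
Proof.
rewrite (_ : (fun _ => _) =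
    fun t : R => t *: delta_mx ord0 ord0 + row_cons (0 : R, v)); last first.
  by apply/funext => t; rewrite -row_cons_shift addr0.
by move=> t; apply: cvgD; [apply: cvgZr_tmp; exact: cvg_id|exact: cvg_cst].
Qed.

(** Moving [t] by [h] moves the point by [h] times the first basis vector, so both derivatives are
    limits of the same difference quotient. *)
Lemma derive1_row_cons m (u : 'rV[R]_m.+1 -> R) (v : 'rV[R]_m) (t : R) :
  (forall x, derivable u x (delta_mx ord0 ord0)) ->
  is_derive t 1 (fun s => u (row_cons (s, v)))
    (partial ord0 u (row_cons (t, v))).
Proof.
move=> du.
pose x := row_cons (t, v).
have E : (fun h : R => h^-1 *: (u (row_cons (h *: (1 : R) + t, v)) - u x)) =
    (fun h : R => h^-1 *: (u (h *: delta_mx ord0 ord0 + x) - u x)).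
  by apply/funext => h; rewrite row_cons_shift scaler1.
split; first by rewrite /derivable /= E; exact: du.
by rewrite /partial /derive /= E.
Qed.

End enorm_gradient.

(** * Lower bound for the integral along a line *)

Section line_integral.
Context {R : realType}.

(** For [t <= d] the left side is at most 0; otherwise [d ^+ p <= t ^+ p] and [t - d <= t]. This
    affine minorant of the power stands in for Jensen's inequality. *)
Lemma tangent_le_exp p (d t : R) :
  0 < d -> 0 <= t -> d ^+ p * (t - d) <= t ^+ p.+1.
Proof.
move=> d0 t0; have [td|dt] := leP t d.
  apply: (@le_trans _ _ 0); rewrite ?exprn_ge0//.
  by rewrite mulr_ge0_le0 ?exprn_ge0 ?subr_le0// ltW.
rewrite exprSr ler_pM ?subr_ge0 ?exprn_ge0 ?(ltW dt) ?(ltW d0)//.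
  by rewrite lerXn2r ?nnegrE ?(ltW dt) ?(ltW d0).
by rewrite gerBl ltW.
Qed.

(** Since the gradient norm is at least the first partial derivative, the affine minorant bounds the
    integrand below by [f]. By the fundamental theorem of calculus, [f] integrates over [[a, b]] to
    [d ^+ p] times the increase of [u] minus [d * (b - a)], that is, to at least [d ^+ p / 2]. *)
Lemma line_integral_ge m (u : 'rV[R]_m.+1 -> R) (v : 'rV[R]_m) (a b L : R) p :
  (forall x, derivable u x (delta_mx ord0 ord0)) ->
  (forall i, continuous (partial i u)) ->
  a < b -> b - a <= L ->
  u (row_cons (a, v)) = 0 -> 1 <= u (row_cons (b, v)) ->
  (((2 * L)^-1 ^+ p / 2)%:E <=
   \int[lebesgue_measure]_t
     (enorm (gradient u (row_cons (t, v))) ^+ p.+1)%:E)%E.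
Proof.
move=> du cu ab baL ua ub.
have L0 : 0 < L by apply: lt_le_trans baL; rewrite subr_gt0.
(* This choice gives [d * (b - a) <= 1/2], which costs at most half of the increase of [u]. *)
set d := (2 * L)^-1; have d0 : 0 < d by rewrite invr_gt0 mulr_gt0.
pose g (t : R) := u (row_cons (t, v)).
pose g' (t : R) := partial ord0 u (row_cons (t, v)).
have dg (t : R) : is_derive t 1 g (g' t) by exact: derive1_row_cons.
pose F : R -> R := fun t => d ^+ p * (g t - d * t).
pose f : R -> R := fun t => d ^+ p * (g' t - d).
have dF (t : R) : is_derive t 1 F (f t).
  have dl : is_derive t 1 (d *: (id : R -> R)) d.
    have := @is_deriveZ _ _ _ (id : R -> R) d t 1 1 (is_derive_id _ _).
    by rewrite /GRing.scale/= mulr1.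
  exact: (@is_deriveZ _ _ _ (g - d *: (id : R -> R)) (d ^+ p) t 1 (g' t - d)).
have cF (t : R) : {for t, continuous F}.
  by apply: differentiable_continuous; apply/derivable1_diffP; case: (dF t).
have cf : continuous f.
  move=> t; apply: cvgM; first exact: cvg_cst.
  apply: cvgB; last exact: cvg_cst.
  by apply: continuous_comp; [exact: continuous_row_cons|exact: cu].
pose h (t : R) := enorm (gradient u (row_cons (t, v))) ^+ p.+1.
have ch : continuous h.
  move=> t; apply: (@continuous_comp _ _ _
    (fun t : R => enorm (gradient u (row_cons (t, v))))
    (fun s : R => s ^+ p.+1)); last exact: exprn_continuous.
  apply: continuous_comp; last exact: continuous_enorm.
  apply: continuous_comp; last exact: continuous_gradient.
  exact: continuous_row_cons.
have h0 t : 0 <= h t by rewrite exprn_ge0// sqrtr_ge0.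
apply: (@le_trans _ _
  (\int[lebesgue_measure]_(t in `[a, b]) (h t)%:E)%E); last first.
  apply: ge0_subset_integral => //.
  - by apply/measurable_EFinP; exact: continuous_measurable_fun.
  - by move=> t _; rewrite lee_fin.
apply: (@le_trans _ _
  (\int[lebesgue_measure]_(t in `[a, b]) (f t)%:E)%E); last first.
  apply: le_integral => //.
  - apply: continuous_compact_integrable; first exact: segment_compact.
    exact: continuous_subspaceT.
  - apply: continuous_compact_integrable; first exact: segment_compact.
    exact: continuous_subspaceT.
  move=> t _; rewrite lee_fin.
  apply: le_trans (@tangent_le_exp p d _ d0 (sqrtr_ge0 _)).
  rewrite ler_wpM2l ?exprn_ge0 ?(ltW d0)// lerB//.
  have := coord_le_enorm _ (gradient u (row_cons (t, v))) ord0.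
  by rewrite mxE.
rewrite (@continuous_FTC2 _ f F) //.
- rewrite -EFinB lee_fin /F -mulrBr ler_wpM2l ?exprn_ge0 ?(ltW d0)//.
  rewrite /g ua.
  have : d * (b - a) <= 2^-1.
    by rewrite /d invfM -mulrA ler_piMr// mulrC ler_pdivrMr// mul1r.
  by move: ub; lra.
- exact: continuous_subspaceT.
- split.
  + by move=> t _; case: (dF t).
  + exact/cvg_at_right_filter/cF.
  + exact/cvg_at_left_filter/cF.
- by move=> t _; rewrite derive1E; case: (dF t).
Qed.

End line_integral.

(** * Positive capacity of cubes *)

Section capacity_cube.
Context {R : realType}.

(** The measure in dimension [m.+1] is by construction the image of a product measure under
    [row_cons]: change variables, then apply Tonelli with the first coordinate innermost. *)
Lemma lebesgue_rV_tonelli m (h : 'rV[R]_m.+1 -> \bar R) :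
  measurable_fun setT h -> (forall x, 0 <= h x)%E ->
  (\int[lebesgue_rV m.+1]_x h x =
   \int[lebesgue_rV m]_v \int[lebesgue_measure]_t h (row_cons (t, v)))%E.
Proof.
move=> mh h0.
have := @ge0_integral_pushforward _ _ _ _ R _ (@measurable_row_cons R m)
  (lebesgue_measure \x lebesgue_rV m)%E setT h measurableT mh (fun x _ => h0 x).
move=> ->; rewrite preimage_setT fubini_tonelli2//.
  by apply: measurableT_comp => //; exact: measurable_row_cons.
by move=> p; exact: h0.
Qed.

Lemma coord_le_norm n (x : 'rV[R]_n) i : `|x ord0 i| <= `|x|.
Proof.
rewrite [leRHS]/Num.norm /= mx_normrE; apply/bigmax_geP; right => /=.
by exists (ord0, i).
Qed.

(** Off its closed support, [u] agrees with 0 on a whole neighbourhood. *)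
Lemma gradient_eq0 n (u : 'rV[R]_n -> R) x :
  ~ closure [set y | u y != 0] x -> gradient u x = 0.
Proof.
move=> clx; apply/rowP => i; rewrite !mxE.
have u0 : {near x, u =1 cst 0}.
  have : nbhs x (~` closure [set y | u y != 0]).
    by apply: open_nbhs_nbhs; split => //; exact/closed_openC/closed_closure.
  apply: (@filterS _ _ (nbhs_filter x)) => y cly.
  apply/eqP; apply: contrapT => /negP uy; apply: cly; exact: subset_closure.
rewrite /partial (near_eq_derive _ u0) ?derive_cst//.
Qed.

(** Every admissible [u] has energy at least [c * (2 * r) ^+ m]: the constant [c] bounds the
    integral along each line over the cross-section [Q] of the cube, and [Q] has measure
    [(2 * r) ^+ m]. *)
Lemma capacity_cube_gt0 m (A C : set 'rV[R]_m.+1) (z : 'rV[R]_m.+1) (r : R) :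
  bounded_set A -> 0 < r ->
  (forall x : 'rV[R]_m.+1, (forall i, `|x ord0 i - z ord0 i| <= r) -> C x) ->
  (0 < capacity A C)%E.
Proof.
move=> bA r0 zC.
have [M M0 AM] : exists2 M, 0 < M & forall x, A x -> `|x| <= M.
  case: bA => M [_ bM]; exists (`|M| + 1); first by rewrite ltr_wpDl.
  by move=> x /bM; apply; rewrite ltr_pwDr// ler_norm.
(* Lines are followed from first coordinate [- (M + 1)], outside [A], to that of [z], which is at
   most [M] in absolute value; [L] bounds this length. *)
pose L := 2 * (M + 1).
pose c := (2 * L)^-1 ^+ m / 2.
pose I (i : 'I_m) : set R :=
  `[z ord0 (lift ord0 i) - r, z ord0 (lift ord0 i) + r]%classic.
pose Q := [set v : 'rV[R]_m | forall i, I i (v ord0 i)].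
have mQ : measurable Q.
  by apply: (@measurable_rV_box _ _ I) => i; exact: measurable_itv.
have muQ : lebesgue_rV m Q = ((2 * r) ^+ m)%:E.
  rewrite (@lebesgue_rV_box _ _ I); last by move=> i; exact: measurable_itv.
  rewrite (eq_bigr (fun=> (2 * r)%:E)); last first.
    move=> i _; rewrite /I lebesgue_measure_itv/= lte_fin.
    by rewrite ifT ?ltrD2l ?gtrN// -EFinB; congr EFin; ring.
  by rewrite prodEFin prodr_const card_ord.
have L0 : 0 < L by rewrite mulr_gt0// addr_gt0.
apply: (@lt_le_trans _ _ (c * (2 * r) ^+ m)%:E).
  have c0 : 0 < c.
    by apply: divr_gt0 => //; apply: exprn_gt0; rewrite invr_gt0 mulr_gt0.
  by rewrite lte_fin mulr_gt0// exprn_gt0// mulr_gt0.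
apply: le_ereal_inf_tmp => _ [u [[smu _ suA] u0 uC] <-].
have [cu dcu] := smu 1%N.
have du i : forall x, derivable u x (delta_mx ord0 i) by case: (dcu i).
have cpu i : continuous (partial i u) by case: (dcu i).
pose h x := (enorm (gradient u x) ^+ m.+1)%:E.
have h0 x : (0 <= h x)%E by rewrite lee_fin exprn_ge0// sqrtr_ge0.
have mh : measurable_fun setT h.
  apply/measurable_EFinP; apply: continuous_measurable_rV => x.
  apply: (@continuous_comp _ _ _ (fun x => enorm (gradient u x))
    (fun s : R => s ^+ m.+1)); last exact: exprn_continuous.
  apply: continuous_comp; last exact: continuous_enorm.
  exact: continuous_gradient.
(* The support of [u] lies in [A], so the gradient vanishes off [A]. *)
have -> : (\int[lebesgue_rV m.+1]_(x in A) h x =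
    \int[lebesgue_rV m.+1]_x h x)%E.
  rewrite integral_mkcond; apply: eq_integral => x _.
  rewrite patchE; case: ifPn => // /negP; rewrite inE => Ax.
  rewrite /h gradient_eq0; last by move=> /suA.
  rewrite (_ : enorm 0 = 0) ?expr0n// /enorm big1 ?sqrtr0// => i _.
  by rewrite mxE expr0n.
rewrite lebesgue_rV_tonelli//.
apply: (@le_trans _ _ (\int[lebesgue_rV m]_(v in Q) c%:E)%E).
  by rewrite EFinM -muQ integral_cst.
have mG : measurable_fun setT
    (fun v => \int[lebesgue_measure]_t h (row_cons (t, v)))%E.
  apply: (@measurable_fun_fubini_tonelli_G _ _ _ _ R lebesgue_measure
    (fun p => h (row_cons p))).
  - by apply: measurableT_comp => //; exact: measurable_row_cons.
  - by move=> p; exact: h0.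
apply: (@le_trans _ _ (\int[lebesgue_rV m]_(v in Q)
    \int[lebesgue_measure]_t h (row_cons (t, v)))%E); last first.
  apply: ge0_subset_integral => // v _; exact: integral_ge0.
have c0 : 0 <= c by rewrite divr_ge0// exprn_ge0// invr_ge0 mulr_ge0// ltW.
apply: ge0_le_integral => //.
- exact: measurable_funTS.
move=> v Qv.
have uM t : u (row_cons (t, v)) != 0 -> `|t| <= M.
  move=> ut; have /AM : A (row_cons (t, v)).
    by apply: suA; exact: subset_closure.
  apply: le_trans.
  by have := coord_le_norm _ (row_cons (t, v)) ord0; rewrite row_cons0.
have uz : 1 <= u (row_cons (z ord0 ord0, v)).
  apply/uC/zC => i; case: (unliftP ord0 i) => [j ->|->].
    rewrite row_consS ler_distlC/=; have := Qv j; rewrite /I /= in_itv/=.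
    by move/andP=> [? ?]; apply/andP; split; lra.
  by rewrite row_cons0 subrr normr0 ltW.
(* The point over [v] with this first coordinate lies in the cube, where [u] is nonzero, hence in
   [A]. *)
have : `|z ord0 ord0| <= M.
  by apply: uM; rewrite gt_eqF// (lt_le_trans _ uz).
rewrite ler_norml => /andP[Mz zM].
apply: (@line_integral_ge _ _ u v (- (M + 1)) (z ord0 ord0)) => //.
- by lra.
- by rewrite /L; lra.
- apply/eqP; apply: contrapT => /negP/uM; rewrite normrN ger0_norm; lra.
Qed.

End capacity_cube.

(** Sup-norm balls are cubes, so the ball contains the closed cube [Q] of half its radius. Every set
    containing [Q] is nonempty and has positive capacity relative to any bounded set, which rules
    out the first two cases of [capacity_zero]; in the unbounded case, [Q] itself is the offending
    compact subset. *)
Lemma capacity_zero_ball {R : realType} m (E : set 'rV[R]_m.+1)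
    (z : 'rV[R]_m.+1) (r : R) :
  0 < r -> ball z r `<=` E -> ~ capacity_zero E.
Proof.
move=> r0 zrE.
pose Q := [set x : 'rV[R]_m.+1 | forall i,
  `[z ord0 i - r / 2, z ord0 i + r / 2]%classic (x ord0 i)].
have zQ (x : 'rV[R]_m.+1) : (forall i, `|x ord0 i - z ord0 i| <= r / 2) -> Q x.
  by move=> xz i /=; rewrite in_itv/= -ler_distl.
have QE : Q `<=` E.
  move=> x Qx; apply: zrE; split => // i j; rewrite (ord1 i) /ball/= distrC.
  have := Qx j; rewrite /= in_itv/= -ler_distl => /le_lt_trans; apply.
  by rewrite ltr_pdivrMr// ltr_pMr// ltr1n.
have r20 : 0 < r / 2 by rewrite divr_gt0.
have Qz : Q z by apply: zQ => i; rewrite subrr normr0 ltW.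
have pos A C : bounded_set A -> Q `<=` C -> capacity A C <> 0%E.
  move=> bA QC AC0; have := @capacity_cube_gt0 R m A C z (r / 2) bA r20.
  by rewrite AC0 ltxx => H; suff: false by []; apply: H => x xz; exact/QC/zQ.
case=> [E0|[_ _ [A [bA _ _]]]|[_ _ Ec]].
- by have := QE _ Qz; rewrite E0.
- exact: pos.
have cQ : compact Q.
  apply: (@rV_compact _ _
    (fun i => `[z ord0 i - r / 2, z ord0 i + r / 2]%classic)) => i.
  exact: segment_compact.
have [A [bA _ _]] := Ec Q (ex_intro _ _ Qz) cQ QE.
exact: pos.
Qed.

(** * Orbits in the attracting basin *)

Section basin.
Context {R : realType} {n : nat}.
Variables (f : 'rV[R]_n -> 'rV[R]_n) (xi : 'rV[R]_n).

Lemma continuous_iter k : continuous f -> continuous (iter k f).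
Proof.
move=> cf; elim: k => [|k IH] x /=; first exact: cvg_id.
by apply: continuous_comp; [exact: IH|exact: cf].
Qed.

(** The orbit of [iter k f x] is a tail of the orbit of [x], and a sequence converges when a tail
    does. *)
Lemma basin_iter k x : basin f xi (iter k f x) -> basin f xi x.
Proof.
rewrite /basin /= => fkx; rewrite -(cvg_shiftn k (fun i => iter i f x))/=.
by under eq_fun do rewrite iterD.
Qed.

Lemma attracting_unif : attracting_fixed_point f xi ->
  exists2 U, nbhs xi U & forall e, 0 < e ->
    exists N, forall k y, (N <= k)%N -> U y -> ball xi e (iter k f y).
Proof.
move=> [_ [U Uxi cvgU]]; exists U => // e e0.
have : nbhs (cst xi : {uniform` U -> _})
    [set h | forall y, U y -> ball xi e (h y)].
  apply/uniform_nbhs; exists [set xy | ball xy.1 e xy.2]; split => //.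
  exact: entourage_ball (PosNum e0).
by move=> /cvgU [N _ NU]; exists N => k y Nk Uy; exact: NU.
Qed.

Lemma nbhs_basin : attracting_fixed_point f xi -> nbhs xi (basin f xi).
Proof.
move=> /attracting_unif[U Uxi cvgU]; apply: filterS Uxi => y Uy.
move=> P /nbhs_ballP[e /= e0 eP]; have [N NU] := cvgU e e0.
by exists N => // k Nk; apply: eP; exact: NU.
Qed.

(** The orbit of [x] enters the interior of [U] at some time [m], and by continuity nearby points
    are in [U] at time [m] too. From time [N + m] on, uniform attraction keeps their orbits within 1
    of [xi]; the finitely many earlier iterates stay within 1 of those of [x], again by
    continuity. *)
Lemma basin_bounded_orbits x : continuous f -> attracting_fixed_point f xi ->
  basin f xi x ->
  exists M, \forall y \near x, forall k, `|iter k f y| <= M.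
Proof.
move=> cf /attracting_unif[U Uxi cvgU] fx; have [N NU] := cvgU 1 ltr01.
have [m _ /(_ m (leqnn _)) Um] := fx _ (nbhs_interior Uxi).
(* A sum of nonnegative bounds serves as a common upper bound in place of a maximum. *)
exists (\sum_(k < N + m) (`|iter k f x| + 1) + (`|xi| + 1)).
have Vm : \forall y \near x, U (iter m f y) by exact: continuous_iter.
have Vk : \forall y \near x, forall k : 'I_(N + m),
    ball (iter k f x) 1 (iter k f y).
  apply: (@filter_forall _ _ _ _ (nbhs_filter x)) => k.
  exact: continuous_iter (nbhsx_ballx _ _ ltr01).
have nb (a b : 'rV[R]_n) : ball a 1 b -> `|b| <= `|a| + 1.
  rewrite mx_norm_ball /ball_/= => ab; rewrite -lerBlDl.
  by apply: ltW; apply: le_lt_trans ab; rewrite distrC; exact: lerB_dist.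
move: Vm Vk; apply: (@filterS2 _ _ (nbhs_filter x)) => y Vmy Vky k.
have s0 : 0 <= \sum_(k < N + m) (`|iter k f x| + 1).
  by apply: sumr_ge0 => i _; rewrite addr_ge0.
have [kNm|Nmk] := ltnP k (N + m).
  apply: le_trans (nb _ _ (Vky (Ordinal kNm))) _.
  rewrite (bigD1 (Ordinal kNm))//= -addrA lerDl addr_ge0 ?addr_ge0//.
  by apply: sumr_ge0 => i _; rewrite addr_ge0.
have mk : (m <= k)%N by exact: leq_trans (leq_addl _ _) Nmk.
apply: (@le_trans _ _ (`|xi| + 1)); last by rewrite lerDr.
apply: nb; rewrite -(subnK mk) iterD; apply: NU => //.
by rewrite leq_subRL// addnC.
Qed.

End basin.

(** * Excluding the basin and the complement of its closure from the Julia set *)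

Theorem theorem1p5 (R : realType) (n : nat) (f : 'rV[R]_n -> 'rV[R]_n)
    (xi : 'rV[R]_n) :
  (2 <= n)%N ->
  quasiregular f ->
  transcendental_type f ->
  attracting_fixed_point f xi ->
  julia f `&` basin f xi = set0 /\ julia f `<=` boundary (basin f xi).
Proof.
case: n => [//|n] in f xi * => _ [cf _] _ fxi.
have J0 x : julia f x -> ~ basin f xi x.
  move=> Jx /(basin_bounded_orbits _ _ _ cf fxi)[M orbM].
  (* Points of the unit ball around this centre have first coordinate above [|M|], so no orbit
     bounded by [M] reaches them. *)
  apply: (capacity_zero_ball _ _ (const_mx (`|M| + 1)) 1 ltr01 _
    (Jx _ (open_interior _) orbM)).
  move=> y [_ /(_ ord0 ord0)]; rewrite mxE /ball/= => yM.
  move=> [k /= _ [w /interior_subset wM yE]].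
  have := le_trans (coord_le_norm _ _ ord0) (wM k); rewrite yE.
  move: yM; rewrite ltr_norml ler_norml => /andP[_ yM] /andP[_ yM'].
  have := ler_norm M; lra.
split.
  by apply/seteqP; split => // x [/J0].
move=> x Jx; split; last by move=> /interior_subset; exact: J0.
apply: contrapT => clx.
have /nbhs_ballP[r /= r0 rA] := nbhs_basin _ _ fxi.
have oU : open (~` closure (basin f xi)).
  exact/closed_openC/closed_closure.
apply: (capacity_zero_ball _ _ _ _ r0 _ (Jx _ oU clx)).
(* If a point [y] of the ball around [xi] were [f^k(w)] with [w] outside the closure of the basin,
   then [w] would be in the basin because [y] is. *)
move=> y /rA Ay [k _ [w clw yE]]; apply/clw/subset_closure.
by apply: (basin_iter _ _ k); rewrite yE.
Qed.
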